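(* Let $E$ be a unital Banach algebra, $1\in B\subset E$ a Banach subalgebra and $Y\in E$, such that $\mathcal{RA}(Y;B)$ is dense in $E$ and carries a GDQ ring structure with comultiplication $\partial:\mathcal{RA}(Y;B)\to\mathcal{RA}(Y;B)\otimes\mathcal{RA}(Y;B)$ satisfying $\partial B=0$ and $\partial Y=1\otimes1$. If $\varphi_1,\varphi_2,\varphi_3\in E'$ are such that $$\varphi_1(a)=(\varphi_2\otimes\varphi_3)(\partial a)\quad\text{for all }a\in\mathcal{RA}(Y;B),$$ then $U(\varphi_1)=U(\varphi_2)U(\varphi_3)$.
   Context: $\mathfrak{M}_n(E)=\mathfrak{M}_n\otimes E$ is the algebra of $n\times n$ matrices over $E$, and $Y\otimes I_n$ is the diagonal matrix with diagonal entries $Y$. The $n$-th $B$-resolvent set of $Y$ is $\rho_n(Y;B)=\{b\in\mathfrak{M}_n(B): Y\otimes I_n-b\text{ is invertible in }\mathfrak{M}_n(E)\}$, $\rho(Y;B)=(\rho_n(Y;B))_{n\ge1}$, and the $n$-th $B$-resolvent is $R_n(Y;B)(b)=(b-Y\otimes I_n)^{-1}$ for $b\in\rho_n(Y;B)$. $\mathcal{RA}(Y;B)$ is the subalgebra of $E$ generated by $B$, $Y$ and all the matrix entries of the $R_n(Y;B)(b)$, $n\ge1$, $b\in\rho_n(Y;B)$. A GDQ ring structure on an algebra $A$ (multiplication $\mu$) is a linear map $\partial:A\to A\otimes A$ (algebraic tensor product) which is coassociative, $(\partial\otimes\mathrm{id})\circ\partial=(\mathrm{id}\otimes\partial)\circ\partial$,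 and a derivation, $\partial\circ\mu=(\mathrm{id}\otimes\mu)\circ(\partial\otimes\mathrm{id})+(\mu\otimes\mathrm{id})\circ(\mathrm{id}\otimes\partial)$. $E'$ is the dual of the Banach space $E$. The full resolvent transform $U$ assigns to $\varphi\in E'$ the sequence $U(\varphi)=(U_n(\varphi))_{n\ge1}$ of functions $U_n(\varphi):\rho_n(Y;B)\to\mathfrak{M}_n$, $U_n(\varphi)(b)=(\varphi\otimes\mathrm{id}_{\mathfrak{M}_n})(R_n(Y;B)(b))$ ($\varphi$ applied to each matrix entry). The product of two such sequences is pointwise: $(U(\varphi_2)U(\varphi_3))_n(b)=U_n(\varphi_2)(b)U_n(\varphi_3)(b)$. *)

(* Defs.v *)
From HB Require Import structures.
From mathcomp Require Import all_boot all_order all_algebra.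
From mathcomp Require Import complex.
From mathcomp Require Import all_classical all_reals topology normedtype.
Import numFieldNormedType.Exports.

Set Implicit Arguments.
Unset Strict Implicit.
Unset Printing Implicit Defensive.

Import Order.TTheory GRing.Theory Num.Theory.
Local Open Scope ring_scope.
Local Open Scope quotient_scope.

(** Algebraic tensor product: an element of [tensor U V] is a class of
    formal sums u_1 ⊗ v_1 + ... + u_n ⊗ v_n, represented by the list of the
    pairs (u_i, v_i), modulo the congruence generated by commutativity and by the
    bilinearity relations.  [tensor_lift_tens], [tensor_lift_linear] and
    [tensor_ext] form the universal property. *)

Section TensorRel.
Context {K : comNzRingType} {U V : lmodType K}.

Inductive tensor_rel : seq (U * V) -> seq (U * V) -> Prop :=
| trel_refl s : tensor_rel s s
| trel_sym s t : tensor_rel s t -> tensor_rel t s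
| trel_trans s t r : tensor_rel s t -> tensor_rel t r -> tensor_rel s r
| trel_cat s s' t t' :
    tensor_rel s s' -> tensor_rel t t' -> tensor_rel (s ++ t) (s' ++ t')
| trel_catC s t : tensor_rel (s ++ t) (t ++ s)
| trel_0l v : tensor_rel [:: (0, v)] [::]
| trel_Dl u u' v : tensor_rel [:: (u + u', v)] [:: (u, v); (u', v)]
| trel_Dr u v v' : tensor_rel [:: (u, v + v')] [:: (u, v); (u, v')]
| trel_Z k u v : tensor_rel [:: (k *: u, v)] [:: (u, k *: v)].

Definition tensor_relb : rel (seq (U * V)) := fun s t => `[< tensor_rel s t >].

Lemma tensor_relb_equiv : equiv_class_of tensor_relb.
Proof.
split.
- by move=> s; apply/asboolP/trel_refl.
- by move=> s t; apply/asboolP/asboolP; apply: trel_sym.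
- by move=> s t r /asboolP h1 /asboolP h2; apply/asboolP; apply: trel_trans h1 h2.
Qed.

Canonical tensor_equiv := EquivRelPack tensor_relb_equiv.

End TensorRel.

Definition tensor {K : comNzRingType} (U V : lmodType K) : Type :=
  {eq_quot (@tensor_equiv K U V)}.

Section TensorModule.
Context {K : comNzRingType} {U V : lmodType K}.
Local Notation T := (tensor U V).

HB.instance Definition _ := Choice.on T.
HB.instance Definition _ :=
  EqQuotient.copy T {eq_quot (@tensor_equiv K U V)}.

Implicit Types (s t : seq (U * V)) (x y z : T).

Lemma tensor_piP s t : reflect (tensor_rel s t) (\pi_T s == \pi_T t).
Proof. by rewrite piE /=; apply: asboolP. Qed.

Lemma tensor_repr s : tensor_rel (repr (\pi_T s)) s.
Proof. by apply/tensor_piP; rewrite reprK. Qed.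

Definition tzero : T := \pi_T [::].
Definition tadd x y : T := \pi_T (repr x ++ repr y).
Definition tscale (k : K) x : T := \pi_T [seq (k *: p.1, p.2) | p <- repr x].
Definition topp x : T := tscale (- 1) x.

Definition tens (u : U) (v : V) : T := \pi_T [:: (u, v)].

Lemma tadd_pi s t : tadd (\pi_T s) (\pi_T t) = \pi_T (s ++ t).
Proof. by apply/eqP/tensor_piP/trel_cat; apply: tensor_repr. Qed.

Lemma tensor_rel_scale k s t : tensor_rel s t ->
  tensor_rel [seq (k *: p.1, p.2) | p <- s] [seq (k *: p.1, p.2) | p <- t].
Proof.
elim=> /= {s t}.
- by move=> s; apply: trel_refl.
- by move=> s t _; apply: trel_sym.
- by move=> s t r _ h1 _ h2; apply: trel_trans h1 h2.
- by move=> s s' t t' _ h1 _ h2; rewrite !map_cat; apply: trel_cat.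
- by move=> s t; rewrite !map_cat; apply: trel_catC.
- by move=> v; rewrite scaler0; apply: trel_0l.
- by move=> u u' v; rewrite scalerDr; apply: trel_Dl.
- by move=> u v v'; apply: trel_Dr.
- by move=> a u v; rewrite scalerA mulrC -scalerA; apply: trel_Z.
Qed.

Lemma tscale_pi k s : tscale k (\pi_T s) = \pi_T [seq (k *: p.1, p.2) | p <- s].
Proof. by apply/eqP/tensor_piP/tensor_rel_scale; apply: tensor_repr. Qed.

Lemma tensor_scaleDl s (a b : K) :
  tensor_rel [seq ((a + b) *: p.1, p.2) | p <- s]
    ([seq (a *: p.1, p.2) | p <- s] ++ [seq (b *: p.1, p.2) | p <- s]).
Proof.
elim: s => [|[u v] s IH] /=; first exact: trel_refl.
rewrite -[X in tensor_rel X _]cat1s scalerDl.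
apply: trel_trans (trel_cat (trel_Dl _ _ _) IH) _ => /=.
set a1 := (a *: u, v); set b1 := (b *: u, v).
set As := map _ s; set Bs := map _ s.
apply: (@trel_cat _ _ _ [:: a1] [:: a1] (b1 :: As ++ Bs) (As ++ b1 :: Bs)); first exact: trel_refl.
rewrite -(cat1s b1 Bs) -(cat1s b1 (As ++ Bs)) !catA.
by apply: trel_cat; [apply: trel_catC | apply: trel_refl].
Qed.

Lemma tensor_scale0 s : tensor_rel [seq (0 *: p.1, p.2) | p <- s] [::].
Proof.
elim: s => [|[u v] s IH] /=; first exact: trel_refl.
rewrite scale0r -cat1s -[X in tensor_rel _ X]cats0.
exact: trel_cat (trel_0l _) IH.
Qed.

Fact taddA : associative tadd.
Proof.
by elim/quotW=> s; elim/quotW=> t; elim/quotW=> r; 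
rewrite (tadd_pi t r) (tadd_pi s t) !tadd_pi catA.
Qed.

Fact taddC : commutative tadd.
Proof.
elim/quotW=> s; elim/quotW=> t; rewrite !tadd_pi.
by apply/eqP/tensor_piP/trel_catC.
Qed.

Fact tadd0 : left_id tzero tadd.
Proof. by elim/quotW=> s; rewrite tadd_pi. Qed.

Fact taddN : left_inverse tzero topp tadd.
Proof.
elim/quotW=> s; rewrite /topp tscale_pi tadd_pi; apply/eqP/tensor_piP.
apply: trel_trans (tensor_scale0 s).
rewrite -(addNr 1); apply: trel_trans (trel_sym (tensor_scaleDl _ _ _)).
apply: trel_cat; first exact: trel_refl.
rewrite -[X in tensor_rel X _]map_id; have -> // : map id s = [seq (1 *: p.1, p.2) | p <- s].
  by apply: eq_map => -[u v] /=; rewrite scale1r.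
exact: trel_refl.
Qed.

HB.instance Definition _ := GRing.isZmodule.Build T taddA taddC tadd0 taddN.

Fact tscaleA a b x : tscale a (tscale b x) = tscale (a * b) x.
Proof.
elim/quotW: x => s; rewrite (tscale_pi b) !tscale_pi -map_comp; congr (\pi_T _).
by apply: eq_map => p /=; rewrite scalerA.
Qed.

Fact tscale1 : left_id 1 tscale.
Proof.
elim/quotW=> s; rewrite tscale_pi; congr (\pi_T _).
by rewrite -[RHS]map_id; apply: eq_map => -[u v] /=; rewrite scale1r.
Qed.

Fact tscaleDr : right_distributive tscale +%R.
Proof.
move=> k; elim/quotW=> s; elim/quotW=> t.
rewrite -[_ + _ in LHS]/(tadd _ _) -[RHS]/(tadd _ _).
by rewrite (tadd_pi s t) !(tscale_pi k) tadd_pi map_cat.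
Qed.

Fact tscaleDl x : {morph tscale^~ x : a b / a + b}.
Proof.
elim/quotW: x => s a b; rewrite -[RHS]/(tadd _ _) !tscale_pi tadd_pi.
exact/eqP/tensor_piP/tensor_scaleDl.
Qed.

HB.instance Definition _ :=
  GRing.Zmodule_isLmodule.Build K T tscaleA tscale1 tscaleDr tscaleDl.

Lemma tens_bilinear : bilinear_for *:%R *:%R tens.
Proof.
have tDl v : {morph tens^~ v : u u' / u + u'}.
  move=> u u'; rewrite -[RHS]/(tadd _ _) tadd_pi.
  exact/eqP/tensor_piP/trel_Dl.
have tDr u : {morph tens u : v v' / v + v'}.
  move=> v v'; rewrite -[RHS]/(tadd _ _) tadd_pi.
  exact/eqP/tensor_piP/trel_Dr.
have tZl k u v : tens (k *: u) v = k *: tens u v.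
  by rewrite -[RHS]/(tscale _ _) tscale_pi.
split=> [v k u u'|u k v v'] /=; first by rewrite tDl tZl.
rewrite tDr -tZl; congr (_ + _).
exact/esym/eqP/tensor_piP/trel_Z.
Qed.

Lemma tensor_pi_sum s : \pi_T s = \sum_(p <- s) tens p.1 p.2.
Proof.
elim: s => [|[u v] s IH]; first by rewrite big_nil.
by rewrite big_cons -IH /= -[RHS]/(tadd _ _) tadd_pi.
Qed.

Lemma tensor_sum x : x = \sum_(p <- repr x) tens p.1 p.2.
Proof. by rewrite -tensor_pi_sum reprK. Qed.

Lemma tensor_ext (W : lmodType K) (f g : {linear T -> W}) :
  (forall u v, f (tens u v) = g (tens u v)) -> f =1 g.
Proof.
move=> fg x; rewrite (tensor_sum x) !linear_sum.
by apply: eq_bigr => p _; apply: fg.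
Qed.

(* The linear map induced by [f], meaningful when [f] is bilinear. *)
Definition tensor_lift {W : lmodType K} (f : U -> V -> W) (x : T) : W :=
  \sum_(p <- repr x) f p.1 p.2.

Section Lift.
Context {W : lmodType K} (f : U -> V -> W).
Hypothesis f_bil : bilinear_for *:%R *:%R f.

Let fDl u u' v : f (u + u') v = f u v + f u' v.
Proof. by have := f_bil.1 v 1 u u'; rewrite /= !scale1r. Qed.
Let fDr u v v' : f u (v + v') = f u v + f u v'.
Proof. by have := f_bil.2 u 1 v v'; rewrite /= !scale1r. Qed.
Let f0l v : f 0 v = 0.
Proof. by apply: (addrI (f 0 v)); rewrite -fDl !addr0. Qed.
Let f0r u : f u 0 = 0.
Proof. by apply: (addrI (f u 0)); rewrite -fDr !addr0. Qed.
Let fZl k u v : f (k *: u) v = k *: f u v.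
Proof. by have := f_bil.1 v k u 0; rewrite /= f0l !addr0. Qed.
Let fZr k u v : f u (k *: v) = k *: f u v.
Proof. by have := f_bil.2 u k v 0; rewrite /= f0r !addr0. Qed.

Lemma tensor_lift_pi s : tensor_lift f (\pi_T s) = \sum_(p <- s) f p.1 p.2.
Proof.
rewrite /tensor_lift; have := tensor_repr s.
move: (repr _) => r; elim=> //= {r s}.
- by move=> s t r _ -> _ ->.
- by move=> s s' t t' _ h1 _ h2; rewrite !big_cat h1 h2.
- by move=> s t; rewrite !big_cat /= addrC.
- by move=> v; rewrite big_seq1 big_nil f0l.
- by move=> u u' v; rewrite !big_cons !big_nil !addr0 /= fDl.
- by move=> u v v'; rewrite !big_cons !big_nil !addr0 /= fDr.
- by move=> k u v; rewrite !big_seq1 /= fZl fZr.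
Qed.

Lemma tensor_lift_tens u v : tensor_lift f (tens u v) = f u v.
Proof. by rewrite tensor_lift_pi big_seq1. Qed.

Lemma tensor_lift_linear : linear (tensor_lift f).
Proof.
move=> k; elim/quotW=> s; elim/quotW=> t.
rewrite -[X in tensor_lift f X]/(tadd (tscale _ _) _) tscale_pi tadd_pi.
rewrite !tensor_lift_pi big_cat big_map scaler_sumr; congr (_ + _).
by apply: eq_bigr => p _ /=; rewrite fZl.
Qed.

End Lift.

End TensorModule.

Notation "u ⊗ v" := (tens u v) (at level 40, left associativity) : ring_scope.

Section TensorMaps.
Context {K : comNzRingType}.
Implicit Types U V W : lmodType K.

Definition tensor_map {U V U' V' : lmodType K} (f : U -> U') (g : V -> V') :
    tensor U V -> tensor U' V' :=
  tensor_lift (fun u v => f u ⊗ g v).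

(* f ⊗ g, for f and g linear forms, followed by the identification K ⊗ K = K *)
Definition tensor_form {U V} (f : U -> K^o) (g : V -> K^o) : tensor U V -> K^o :=
  tensor_lift (fun u v => (f u * g v : K^o)).

Definition tensor_assoc {U V W} :
    tensor (tensor U V) W -> tensor U (tensor V W) :=
  tensor_lift (fun x w => tensor_lift (fun u v => u ⊗ (v ⊗ w)) x).

Definition tensor_assocV {U V W} :
    tensor U (tensor V W) -> tensor (tensor U V) W :=
  tensor_lift (fun u y => tensor_lift (fun v w => (u ⊗ v) ⊗ w) y).

Lemma tensPl {U V} k (u u' : U) (v : V) :
  (k *: u + u') ⊗ v = k *: (u ⊗ v) + u' ⊗ v.
Proof. exact: (tens_bilinear.1 v). Qed.

Lemma tensPr {U V} k (u : U) (v v' : V) :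
  u ⊗ (k *: v + v') = k *: (u ⊗ v) + u ⊗ v'.
Proof. exact: (tens_bilinear.2 u). Qed.

Lemma tensor_map_tens {U V U' V' : lmodType K} (f : {linear U -> U'})
    (g : {linear V -> V'}) u v :
  tensor_map f g (u ⊗ v) = f u ⊗ g v.
Proof.
by apply: tensor_lift_tens; split=> [z k x y|z k x y] /=;
  rewrite linearP ?tensPl ?tensPr.
Qed.

Lemma tensor_form_tens {U V} (f : {linear U -> K^o}) (g : {linear V -> K^o}) u v :
  tensor_form f g (u ⊗ v) = f u * g v.
Proof.
apply: tensor_lift_tens; split=> [z k x y|z k x y] /=; rewrite linearP /=.
- by rewrite mulrDl scalerAl.
- by rewrite mulrDr scalerAr.
Qed.

Lemma tensor_assoc_tens {U V W} (u : U) (v : V) (w : W) :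
  tensor_assoc ((u ⊗ v) ⊗ w) = u ⊗ (v ⊗ w).
Proof.
have bil z : bilinear_for *:%R *:%R (fun (u : U) (v : V) => u ⊗ (v ⊗ z)).
  by split=> [a k x y|a k x y] /=; rewrite ?tensPl ?tensPr.
rewrite /tensor_assoc !tensor_lift_tens //.
split=> [z k x y|z k x y] /=; first exact: tensor_lift_linear.
rewrite /tensor_lift scaler_sumr -big_split /=.
by apply: eq_bigr => p _; rewrite !tensPr.
Qed.

Lemma tensor_assocV_tens {U V W} (u : U) (v : V) (w : W) :
  tensor_assocV (u ⊗ (v ⊗ w)) = (u ⊗ v) ⊗ w.
Proof.
have bil z : bilinear_for *:%R *:%R (fun (v : V) (w : W) => (z ⊗ v) ⊗ w).
  by split=> [a k x y|a k x y] /=; rewrite ?tensPr ?tensPl.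
rewrite /tensor_assocV !tensor_lift_tens //.
split=> [z k x y|z k x y] /=; last exact: tensor_lift_linear.
rewrite /tensor_lift scaler_sumr -big_split /=.
by apply: eq_bigr => p _; rewrite !tensPl.
Qed.

End TensorMaps.

(* [tensor_assoc] and [tensor_assocV] are the identifications
   (A ⊗ A) ⊗ A = A ⊗ (A ⊗ A) that are implicit in the usual formulas. *)
Section GDQ.
Context {K : comNzRingType} {A : algType K}.

Definition tensor_mul : tensor A A -> A := tensor_lift *%R.

Lemma tensor_mul_tens a b : tensor_mul (a ⊗ b) = a * b.
Proof.
apply: tensor_lift_tens; split=> [z k x y|z k x y] /=.
- by rewrite mulrDl scalerAl.
- by rewrite mulrDr scalerAr.
Qed.

Definition coassociative (d : A -> tensor A A) : Prop :=
  tensor_assoc \o tensor_map d id \o d =1 tensor_map id d \o d.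

Definition tensor_derivation (d : A -> tensor A A) : Prop :=
  forall t : tensor A A,
    d (tensor_mul t) =
      tensor_map id tensor_mul (tensor_assoc (tensor_map d id t))
      + tensor_map tensor_mul id (tensor_assocV (tensor_map id d t)).

Record is_GDQ (d : A -> tensor A A) : Prop := IsGDQ {
  GDQ_linear : linear d;
  GDQ_coassoc : coassociative d;
  GDQ_derivation : tensor_derivation d }.

End GDQ.

Section GenSubalg.
Context {K : nzRingType} {A : algType K}.

Definition gen_subalg (S : set A) : set A :=
  [set x | forall C : set A, subalg_closed [in C] -> (S `<=` C)%classic -> C x].

Definition gen_subalg_pred (S : set A) : {pred A} := fun x => `[< gen_subalg S x >].

Fact gen_subalg_closed S : GRing.subsemialg_closed (gen_subalg_pred S).
Proof.
apply: GRing.subalg_closed_semi; split.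
- apply/asboolP => C [C1 _ _] _; exact: set_mem.
- move=> a x y /asboolP hx /asboolP hy; apply/asboolP => C hC SC.
  have [_ CZ _] := hC.
  by have /set_mem := CZ a x y (mem_set (hx C hC SC)) (mem_set (hy C hC SC)).
- move=> x y /asboolP hx /asboolP hy; apply/asboolP => C hC SC.
  have [_ _ CM] := hC.
  by have /set_mem := CM x y (mem_set (hx C hC SC)) (mem_set (hy C hC SC)).
Qed.

HB.instance Definition _ S :=
  GRing.isSubalgClosed.Build K A (gen_subalg_pred S) (gen_subalg_closed S).

Record gen_subalg_type (S : set A) := GenSubalg {
  gen_subalg_val : A;
  _ : gen_subalg_val \in gen_subalg_pred S }.

HB.instance Definition _ S := [isSub for @gen_subalg_val S].
HB.instance Definition _ S := [Choice of gen_subalg_type S by <:].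
HB.instance Definition _ S :=
  [SubChoice_isSubAlgebra of gen_subalg_type S by <:].

End GenSubalg.

HB.mixin Record isBanachAlgebra (K : numFieldType) E
    of CompleteNormedModule K E := {
  bmul : E -> E -> E;
  bone : E;
  bmulA : associative bmul;
  bmul1l : left_id bone bmul;
  bmul1r : right_id bone bmul;
  bmulDl : left_distributive bmul +%R;
  bmulDr : right_distributive bmul +%R;
  bscaleAl : forall (k : K) (x y : E), k *: bmul x y = bmul (k *: x) y;
  bscaleAr : forall (k : K) (x y : E), k *: bmul x y = bmul x (k *: y);
  norm_bmul : forall x y : E, `|bmul x y| <= `|x| * `|y|;
  norm_bone : `|bone| = 1 }.

#[short(type="banachAlgType")]
HB.structure Definition BanachAlgebra (K : numFieldType) :=
  {E of CompleteNormedModule K E & isBanachAlgebra K E}.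

(* The hierarchies of rings and of normed modules cannot be joined a posteriori,
   so [bmul] and [bone] are turned into the ring operations by instances on the
   carrier. *)
Section BanachAlgebraRing.
Context {K : numFieldType} (E : banachAlgType K).
Local Notation E' := (BanachAlgebra.sort E).

Fact bone_neq0 : bone != 0 :> E'.
Proof. by rewrite -normr_eq0 norm_bone oner_neq0. Qed.

HB.instance Definition _ := GRing.Zmodule_isNzRing.Build E'
  bmulA bmul1l bmul1r bmulDl bmulDr bone_neq0.
HB.instance Definition _ := GRing.Lmodule_isLalgebra.Build K E' bscaleAl.
HB.instance Definition _ := GRing.Lalgebra_isAlgebra.Build K E' bscaleAr.

End BanachAlgebraRing.

Record dual {K : numFieldType} (E : banachAlgType K) := Dual {
  dual_linear :> {linear E -> K^o};
  dual_continuous : continuous (dual_linear : E -> K^o) }.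

Section MatrixInverse.
Context {A : nzRingType} {n : nat}.
Implicit Types M N : 'M[A]_n.

Definition mx_inverse_of M N : Prop := M *m N = 1%:M /\ N *m M = 1%:M.

Definition mx_invertible M : Prop := exists N, mx_inverse_of M N.

(* [unitmx] and [invmx] are only available over commutative rings; [mx_inv M] is
   0 when [M] is not invertible. *)
Definition mx_inv M : 'M[A]_n := xget 0 [set N | mx_inverse_of M N]%classic.

Lemma mx_invP M : mx_invertible M -> mx_inverse_of M (mx_inv M).
Proof. by case=> N hN; apply: (xgetPex 0); exists N. Qed.

End MatrixInverse.

Section Resolvent.
Context {K : numFieldType} {E : banachAlgType K}.
Implicit Types (B : set E) (Y : E).

Definition banach_subalgebra B : Prop := subalg_closed [in B] /\ closed B.

Definition resolvent_set Y B n : set 'M[E]_n :=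
  [set b : 'M[E]_n | (forall i j, B (b i j)) /\ mx_invertible (Y%:M - b)].

Definition resolvent Y n (b : 'M[E]_n) : 'M[E]_n := mx_inv (b - Y%:M).

Definition resolvent_entries Y B : set E :=
  [set z | exists n (b : 'M[E]_n) (i j : 'I_n),
     [/\ (0 < n)%N, resolvent_set Y B b & z = resolvent Y b i j]].

Definition RA_generators Y B : set E :=
  (B `|` [set Y] `|` resolvent_entries Y B)%classic.

Definition RA Y B : set E := gen_subalg (RA_generators Y B).

Definition RA_alg Y B : algType K := gen_subalg_type (RA_generators Y B).

Definition RA_val Y B : RA_alg Y B -> E := val.

Definition resolvent_transform Y (phi : dual E) n (b : 'M[E]_n) : 'M[K]_n :=
  map_mx phi (resolvent Y b).

End Resolvent.

Arguments RA_val {K E Y B} _.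

(* Main.v *)
Require Import Defs.
From HB Require Import structures.
From mathcomp Require Import all_boot all_order all_algebra.
From mathcomp Require Import complex.
From mathcomp Require Import all_classical all_reals topology normedtype.
Import numFieldNormedType.Exports.
Import Order.TTheory GRing.Theory Num.Theory.
Local Open Scope ring_scope.

(** Let r = (b - Y)^-1 with entries in RA(Y;B).  Since d kills B and sends Y to
    1 ⊗ 1, applying the derivation d to (b - Y) r = 1 gives
    sum_k (b - Y)_ik . d(r_kj) = 1 ⊗ r_ij, where a . (u ⊗ v) = a u ⊗ v.
    Letting r act on the left yields d(r_ij) = sum_k r_ik ⊗ r_kj, i.e. r is a
    corepresentation, and phi2 ⊗ phi3 turns this into the matrix product. *)

(** * Linearity of the maps induced on tensor products *)

Section TensorMapLinear.
Context {K : comNzRingType} {U V U' V' W : lmodType K}.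

Lemma tensor_map_linear (f : {linear U -> U'}) (g : {linear V -> V'}) :
  linear (tensor_map f g).
Proof.
apply: tensor_lift_linear; split=> [z k x y|z k x y] /=;
  by rewrite linearP ?tensPl ?tensPr.
Qed.

Lemma tensor_form_linear (f : {linear U -> K^o}) (g : {linear V -> K^o}) :
  linear (tensor_form f g).
Proof.
apply: tensor_lift_linear; split=> [z k x y|z k x y] /=; rewrite linearP /=.
- by rewrite mulrDl scalerAl.
- by rewrite mulrDr scalerAr.
Qed.

Lemma tensor_assoc_linear : linear (@tensor_assoc K U V W).
Proof.
have bil (z : W) : bilinear_for *:%R *:%R (fun (u : U) (v : V) => u ⊗ (v ⊗ z)).
  by split=> [a k x y|a k x y] /=; rewrite ?tensPl ?tensPr.
apply: tensor_lift_linear; split=> [z k x y|z k x y] /=.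
  exact: (tensor_lift_linear (bil z)).
rewrite /tensor_lift scaler_sumr -big_split /=.
by apply: eq_bigr => p _; rewrite !tensPr.
Qed.

Lemma tensor_assocV_linear : linear (@tensor_assocV K U V W).
Proof.
have bil (z : U) : bilinear_for *:%R *:%R (fun (v : V) (w : W) => (z ⊗ v) ⊗ w).
  by split=> [a k x y|a k x y] /=; rewrite ?tensPr ?tensPl.
apply: tensor_lift_linear; split=> [z k x y|z k x y] /=; last first.
  exact: (tensor_lift_linear (bil z)).
rewrite /tensor_lift scaler_sumr -big_split /=.
by apply: eq_bigr => p _; rewrite !tensPl.
Qed.

End TensorMapLinear.

HB.instance Definition _ (K : comNzRingType) (U V U' V' : lmodType K)
    (f : {linear U -> U'}) (g : {linear V -> V'}) :=
  GRing.isLinear.Build K (tensor U V) (tensor U' V') *:%R (tensor_map f g)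
    (tensor_map_linear f g).

HB.instance Definition _ (K : comNzRingType) (U V : lmodType K)
    (f : {linear U -> K^o}) (g : {linear V -> K^o}) :=
  GRing.isLinear.Build K (tensor U V) K^o *:%R (tensor_form f g)
    (tensor_form_linear f g).

HB.instance Definition _ (K : comNzRingType) (U V W : lmodType K) :=
  GRing.isLinear.Build K (tensor (tensor U V) W) (tensor U (tensor V W)) *:%R
    (@tensor_assoc K U V W) tensor_assoc_linear.

HB.instance Definition _ (K : comNzRingType) (U V W : lmodType K) :=
  GRing.isLinear.Build K (tensor U (tensor V W)) (tensor (tensor U V) W) *:%R
    (@tensor_assocV K U V W) tensor_assocV_linear.

(** * The bimodule A ⊗ A and derivations into it *)

Section GDQ.
Context {K : comNzRingType} {A : algType K}.
Implicit Types (x y : A) (t : tensor A A).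

Lemma tensor_mul_linear : linear (@tensor_mul K A).
Proof.
apply: tensor_lift_linear; split=> [z k x y|z k x y] /=.
- by rewrite mulrDl scalerAl.
- by rewrite mulrDr scalerAr.
Qed.

HB.instance Definition _ :=
  GRing.isLinear.Build K (tensor A A) A *:%R (@tensor_mul K A) tensor_mul_linear.

(** Together with [tensor_ract] this is the outer bimodule structure on A ⊗ A, in which
    [tensor_derivation] becomes the usual Leibniz rule. *)
Definition tensor_lact x : tensor A A -> tensor A A :=
  tensor_lift (fun u v => (x * u) ⊗ v).

Definition tensor_ract y : tensor A A -> tensor A A :=
  tensor_lift (fun u v => u ⊗ (v * y)).

Lemma tensor_lact_bilinear x :
  bilinear_for *:%R *:%R (fun u v : A => (x * u) ⊗ v).
Proof.
split=> [z k u v|z k u v] /=; last by rewrite tensPr.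
by rewrite mulrDr -scalerAr tensPl.
Qed.

Lemma tensor_ract_bilinear y :
  bilinear_for *:%R *:%R (fun u v : A => u ⊗ (v * y)).
Proof.
split=> [z k u v|z k u v] /=; first by rewrite tensPl.
by rewrite mulrDl -scalerAl tensPr.
Qed.

Lemma tensor_lact_tens x u v : tensor_lact x (u ⊗ v) = (x * u) ⊗ v.
Proof. exact/tensor_lift_tens/tensor_lact_bilinear. Qed.

Lemma tensor_ract_tens y u v : tensor_ract y (u ⊗ v) = u ⊗ (v * y).
Proof. exact/tensor_lift_tens/tensor_ract_bilinear. Qed.

HB.instance Definition _ x :=
  GRing.isLinear.Build K (tensor A A) (tensor A A) *:%R (tensor_lact x)
    (tensor_lift_linear (tensor_lact_bilinear x)).

HB.instance Definition _ y :=
  GRing.isLinear.Build K (tensor A A) (tensor A A) *:%R (tensor_ract y)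
    (tensor_lift_linear (tensor_ract_bilinear y)).

(** Identifies the first term of [tensor_derivation]: on a pure tensor, (u ⊗ v) ⊗ y is reassociated
    to u ⊗ (v ⊗ y) and multiplied out to u ⊗ v y. *)
Lemma tensor_ract_assoc t y :
  tensor_map id tensor_mul (tensor_assoc (t ⊗ y)) = tensor_ract y t.
Proof.
have -> : t ⊗ y = \sum_(p <- repr t) (p.1 ⊗ p.2) ⊗ y.
  (* [s ↦ s ⊗ y] is packed as a linear map so that [linear_sum] applies to it. *)
  pose l := GRing.isLinear.Build K (tensor A A) (tensor (tensor A A) A) *:%R
    (fun s => s ⊗ y) (tens_bilinear.1 y).
  pose f : {linear _ -> _} := HB.pack (fun s => s ⊗ y) l.
  by rewrite {1}(tensor_sum t) -[LHS]/(f _) linear_sum.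
(* Conversion to [idfun], whose linear structure is needed to push the maps through the sum. *)
rewrite -[tensor_map id]/(tensor_map idfun) {2}(tensor_sum t).
rewrite (linear_sum tensor_assoc) (linear_sum (tensor_map idfun tensor_mul)).
rewrite (linear_sum (tensor_ract y)).
apply: eq_bigr => p _ /=.
by rewrite tensor_assoc_tens tensor_map_tens /= tensor_mul_tens tensor_ract_tens.
Qed.

Lemma tensor_lact_assoc x t :
  tensor_map tensor_mul id (tensor_assocV (x ⊗ t)) = tensor_lact x t.
Proof.
have -> : x ⊗ t = \sum_(p <- repr t) x ⊗ (p.1 ⊗ p.2).
  pose l := GRing.isLinear.Build K (tensor A A) (tensor A (tensor A A)) *:%R
    (tens x) (tens_bilinear.2 x).
  pose f : {linear _ -> _} := HB.pack (tens x) l.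
  by rewrite {1}(tensor_sum t) -[LHS]/(f _) linear_sum.
rewrite -[tensor_map _ id]/(tensor_map _ idfun) {2}(tensor_sum t).
rewrite (linear_sum tensor_assocV) (linear_sum (tensor_map tensor_mul idfun)).
rewrite (linear_sum (tensor_lact x)).
apply: eq_bigr => p _ /=.
by rewrite tensor_assocV_tens tensor_map_tens /= tensor_mul_tens tensor_lact_tens.
Qed.

Lemma tensor_lactM x y t :
  tensor_lact x (tensor_lact y t) = tensor_lact (x * y) t.
Proof.
rewrite (tensor_sum t) (linear_sum (tensor_lact y)).
rewrite (linear_sum (tensor_lact x)) (linear_sum (tensor_lact (x * y))).
by apply: eq_bigr => p _ /=; rewrite !tensor_lact_tens mulrA.
Qed.

Lemma tensor_lact1 t : tensor_lact 1 t = t.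
Proof.
rewrite [RHS](tensor_sum t) {1}(tensor_sum t) linear_sum.
by apply: eq_bigr => p _ /=; rewrite tensor_lact_tens mul1r.
Qed.

Lemma tensor_ract1 t : tensor_ract 1 t = t.
Proof.
rewrite [RHS](tensor_sum t) {1}(tensor_sum t) linear_sum.
by apply: eq_bigr => p _ /=; rewrite tensor_ract_tens mulr1.
Qed.

(** Additivity in the acting element; with [tensor_lact0l] it lets [big_morph] split the action of
    an entry of a matrix product. *)
Lemma tensor_lactDl t : {morph tensor_lact^~ t : x y / x + y}.
Proof.
move=> x y /=; rewrite (tensor_sum t) !linear_sum -big_split.
apply: eq_bigr => p _ /=; rewrite !tensor_lact_tens mulrDl.
by rewrite -[x * _]scale1r tensPl !scale1r.
Qed.

Lemma tensor_lact0l t : tensor_lact 0 t = 0.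
Proof. by apply: (addrI (tensor_lact 0 t)); rewrite -tensor_lactDl !addr0. Qed.

(** * The Leibniz rule and the derivative of an inverse matrix *)

Section Derivation.
Context (d : A -> tensor A A) (d_GDQ : is_GDQ d).

HB.instance Definition _ :=
  GRing.isLinear.Build K A (tensor A A) *:%R d (GDQ_linear d_GDQ).

(** The derivation axiom evaluated at the pure tensor x ⊗ y. *)
Lemma GDQ_mul x y : d (x * y) = tensor_ract y (d x) + tensor_lact x (d y).
Proof.
have := GDQ_derivation d_GDQ (x ⊗ y); rewrite tensor_mul_tens => ->.
rewrite (tensor_map_tens d idfun) (tensor_map_tens idfun d).
by rewrite tensor_ract_assoc tensor_lact_assoc.
Qed.

Lemma GDQ_1 : d 1 = 0.
Proof.
apply: (addrI (d 1)); rewrite addr0 -[RHS](congr1 d (mul1r 1)) GDQ_mul.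
by rewrite tensor_ract1 tensor_lact1.
Qed.

(** Here [X] stands for b - Y and [M] for the resolvent, whence the minus sign in the hypothesis on
    d. *)
Lemma GDQ_inverse n (X M : 'M[A]_n) : mx_inverse_of X M ->
    (forall i j, d (X i j) = (1 ⊗ 1) *- (i == j)) ->
  forall i j, d (M i j) = \sum_k M i k ⊗ M k j.
Proof.
move=> [XM MX] dX i j.
(* Entry (k, j) of X M = 1 is differentiated: the right side dies by [GDQ_1], and among the terms
   where d hits X only l = k survives, giving -(1 ⊗ M k j). *)
have XdM k : \sum_l tensor_lact (X k l) (d (M l j)) = 1 ⊗ M k j.
  have /(congr1 d) : (X *m M) k j = (k == j)%:R by rewrite XM mxE.
  rewrite linearMn /= GDQ_1 mul0rn mxE linear_sum /=.
  under eq_bigr do rewrite GDQ_mul dX.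
  rewrite big_split /= (bigD1 k) //= big1 ?addr0 => [|l /negPf lk].
    by rewrite eqxx linearN /= tensor_ract_tens mul1r => /eqP;
       rewrite addrC subr_eq0 => /eqP.
  by rewrite eq_sym lk mulr0n oppr0 linear0.
(* Since M X = 1, this sum collapses to l = i. Expanding M X instead, and exchanging the sums,
   exposes [XdM] under the action of M i k. *)
transitivity (\sum_l tensor_lact ((M *m X) i l) (d (M l j))).
  rewrite MX (bigD1 i) //= big1 ?addr0 => [|l /negPf li].
    by rewrite mxE eqxx tensor_lact1.
  by rewrite mxE eq_sym li tensor_lact0l.
under eq_bigr => l _.
  rewrite mxE (big_morph _ (tensor_lactDl _) (tensor_lact0l _)).
  under eq_bigr do rewrite -tensor_lactM.
  over.
rewrite exchange_big; apply: eq_bigr => k _ /=.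
by rewrite -linear_sum XdM /= tensor_lact_tens mulr1.
Qed.

End Derivation.
End GDQ.

(** * RA(Y;B) as an algebra mapped into E *)

Section ResolventAlgebra.
Context {K : numFieldType} {E : banachAlgType K} {B : set E} {Y : E}.

(** A [sig] rather than an existential, so that lifts of matrix entries can be assembled directly
    into a matrix. *)
Lemma RA_generator (x : E) :
  RA_generators Y B x -> {a : RA_alg Y B | RA_val a = x}.
Proof.
move=> gx; have xRA : x \in gen_subalg_pred (RA_generators Y B).
  by apply/asboolP => C _; apply.
by exists (GenSubalg xRA).
Qed.

Lemma RA_val_linear : linear (RA_val : RA_alg Y B -> E).
Proof. by move=> k x y; rewrite /RA_val linearP. Qed.

Lemma RA_val_monoid_morphism : monoid_morphism (RA_val : RA_alg Y B -> E).
Proof. by []. Qed.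

HB.instance Definition _ :=
  GRing.isLinear.Build K (RA_alg Y B) E *:%R (@RA_val K E Y B) RA_val_linear.

HB.instance Definition _ :=
  GRing.isMonoidMorphism.Build (RA_alg Y B) E (@RA_val K E Y B)
    RA_val_monoid_morphism.

End ResolventAlgebra.

Theorem proposition9p6 (R : realType) (E : banachAlgType R[i])
    (B : set E) (Y : E)
    (B_subalg : banach_subalgebra B)
    (RA_dense : dense (RA Y B))
    (d : RA_alg Y B -> tensor (RA_alg Y B) (RA_alg Y B))
    (d_GDQ : is_GDQ d)
    (dB : forall b : RA_alg Y B, B (RA_val b) -> d b = 0)
    (dY : forall y : RA_alg Y B, RA_val y = Y -> d y = 1 ⊗ 1)
    (phi1 phi2 phi3 : dual E)
    (phi_d : forall a : RA_alg Y B,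
       phi1 (RA_val a) = tensor_form (phi2 \o RA_val) (phi3 \o RA_val) (d a)) :
  forall n : nat, (0 < n)%N -> forall b : 'M[E]_n, resolvent_set Y B b ->
    resolvent_transform Y phi1 b =
      resolvent_transform Y phi2 b *m resolvent_transform Y phi3 b.
Proof.
move=> n n_gt0 b bY; have [bB [N [YbN NYb]]] := bY.
have : mx_invertible (b - Y%:M).
  (* The resolvent set inverts Y - b but the resolvent inverts b - Y, hence the sign. *)
  exists (- N); rewrite -opprB /mx_inverse_of.
  by rewrite mulNmx mulmxN opprK mulNmx mulmxN opprK.
(* Invertibility excludes the default value 0 of [mx_inv]. *)
move/mx_invP; rewrite -/(resolvent Y b) => -[XM MX].
have bRA i j : {a : RA_alg Y B | RA_val a = b i j}.
  by apply: RA_generator; left; left; apply: bB.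
have [y yY] : {y : RA_alg Y B | RA_val y = Y}.
  by apply: RA_generator; left; right.
have rRA i j : {a : RA_alg Y B | RA_val a = resolvent Y b i j}.
  by apply: RA_generator; right; exists n, b, i, j.
(* The resolvent and b - Y are lifted to matrices over [RA_alg Y B], where d is defined. *)
pose M := \matrix_(i, j) sval (rRA i j).
pose X := \matrix_(i, j) sval (bRA i j) - y%:M.
have MV : map_mx RA_val M = resolvent Y b.
  by apply/matrixP => i j; rewrite !mxE; exact: (svalP (rRA i j)).
have XV : map_mx RA_val X = b - Y%:M.
  apply/matrixP => i j; rewrite !mxE linearB linearMn /= yY.
  by rewrite (svalP (bRA i j)).
have dX i j : d (X i j) = (1 ⊗ 1) *- (i == j).
  have dbij : d (sval (bRA i j)) = 0.
    by apply: dB; rewrite (svalP (bRA i j)); apply: bB.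
  rewrite !mxE; case: eqP => _; last by rewrite !mulr0n subr0 oppr0.
  by rewrite addrC -scaleN1r (GDQ_linear d_GDQ) dbij addr0 scaleN1r dY.
have inv : mx_inverse_of X M.
  (* The inverse relations hold over E and are pulled back along the injective ring morphism
     [RA_val], applied entrywise. *)
  have map_inj : injective (map_mx RA_val : 'M[RA_alg Y B]_n -> 'M[E]_n).
    move=> P Q PQ; apply/matrixP => i j; apply: val_inj.
    by have /matrixP/(_ i j) := PQ; rewrite !mxE.
  by split; apply: map_inj; rewrite map_mxM map_mx1 MV XV.
apply/matrixP => i j.
rewrite /resolvent_transform -MV -!map_mx_comp mxE [RHS]mxE /= phi_d.
rewrite (GDQ_inverse d d_GDQ n X M inv dX) linear_sum.
apply: eq_bigr => k _; rewrite [X in _ = X * _]mxE [X in _ = _ * X]mxE.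
exact: tensor_form_tens.
Qed.
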